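(* Let $q$ be a prime power and $n\ge 3$. If $F:\mathrm{GF}(q)^n\to\mathrm{GF}(q)^n$ is affine, i.e. $F(x)=Ax+v$ for some matrix $A\in\mathrm{GF}(q)^{n\times n}$ and vector $v\in\mathrm{GF}(q)^n$, then $F$ is not Hamiltonian.
   Context: A map $F:Q^n\to Q^n$ is Hamiltonian if its functional graph $x\mapsto F(x)$ consists of a single cycle of length $q^n$ (i.e. $F$ is a cyclic permutation of all $q^n$ configurations). *)

(* Defs.v *)
From mathcomp Require Import all_boot all_order all_algebra.
Set Implicit Arguments.
Unset Strict Implicit.
Unset Printing Implicit Defensive.

(* Configurations in Q^n are column vectors, for an arbitrary finite alphabet Q.
   [ufcycle F c] says that c lists distinct configurations, each being mapped
   by F to the next one and the last one to the first; having length #|Q| ^ n,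
   such a c exhausts Q^n. *)
Definition hamiltonian (Q : finType) (n : nat) (F : 'cV[Q]_n -> 'cV[Q]_n) :
    Prop :=
  exists2 c : seq 'cV[Q]_n, ufcycle F c & size c = #|Q| ^ n.

(* Main.v *)
(* If F is Hamiltonian then F^N = id with N = q^n a power of p, so the minimal
   polynomial of A divides X^N - 1 = (X - 1)^N and is therefore (X - 1)^d with
   d <= n.  Now F^m x - x = S_m(A) (F x - x) with S_m = 1 + X + ... + X^(m-1),
   and for m a power of p, S_m = (X - 1)^(m - 1).  For m = p^(n-1) > n this
   kills A, so F^m = id although m < N. *)
Require Import Defs.
From mathcomp Require Import all_boot all_order all_algebra all_field.
Set Implicit Arguments.
Unset Strict Implicit.
Unset Printing Implicit Defensive.
Import GRing.Theory.
Local Open Scope ring_scope.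

(** Multiplied by ['X - 1], both sides equal ['X^(p ^ e) - 1]: the left by the geometric sum, the
    right by Frobenius. The factor then cancels. *)
Lemma sum_Xn_pchar (R : idomainType) (p e : nat) : p \in [pchar R] ->
  \sum_(i < p ^ e) 'X^i = ('X - 1) ^+ (p ^ e).-1 :> {poly R}.
Proof.
move=> charRp; have p_pr := pcharf_prime charRp.
have charXp : p \in [pchar {poly R}] by rewrite pchar_poly.
have nz : 'X - 1 != 0 :> {poly R} by rewrite monic_neq0 ?monicXsubC.
apply: (mulfI nz); rewrite -subrX1 -exprS prednK ?expn_gt0 ?prime_gt0 //.
rewrite -{1}['X](subrK 1) exprDn_pchar ?expr1n ?addrK //.
by rewrite pnatX (eq_pnat _ (pcharf_eq charXp)) pnat_id.
Qed.

Section AffineMap.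

Variables (K : fieldType) (n : nat) (F : 'cV[K]_n.+1 -> 'cV[K]_n.+1).
Variables (A : 'M[K]_n.+1) (v : 'cV[K]_n.+1).
Hypothesis FE : forall x, F x = A *m x + v.

Lemma iter_affineB m x y : iter m F x - iter m F y = A ^+ m *m (x - y).
Proof.
elim: m => [|m IHm] /=; first by rewrite expr0 mul1mx.
by rewrite !FE opprD addrACA subrr addr0 -mulmxBr IHm mulmxA mulmxE -exprS.
Qed.

(** Telescoping: the increment from [iter i F x] to [iter i.+1 F x] is [A ^+ i *m (F x - x)]. *)
Lemma iter_affine_subl m x :
  iter m F x - x = horner_mx A (\sum_(i < m) 'X^i) *m (F x - x).
Proof.
elim: m => [|m IHm]; first by rewrite big_ord0 rmorph0 mul0mx subrr.
rewrite big_ord_recr rmorphD /= mulmxDl -IHm rmorphXn /= horner_mx_X.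
by rewrite -iter_affineB -iterSr [RHS]addrC subrKA.
Qed.

Lemma mxminpoly_iter_affine N :
  (forall x, iter N F x = x) -> mxminpoly A %| 'X^N - 1.
Proof.
move=> FN; apply: mxminpoly_min.
rewrite rmorphB rmorphXn rmorph1 /= horner_mx_X; apply/eqP; rewrite subr_eq0.
(* Column [j] of [A ^+ N] is the difference of the [N]-th iterates at [delta_mx j 0] and [0], both
   fixed points of [iter N F]. *)
apply/eqP/trmx_inj/row_matrixP=> j; rewrite -!tr_col !colE mul1mx.
by rewrite -[delta_mx j 0]subr0 -iter_affineB !FN.
Qed.

Lemma iter_affine_pchar (p a b : nat) :
    p \in [pchar K] -> (forall x, iter (p ^ a) F x = x) -> (n.+1 < p ^ b)%N ->
  forall x, iter (p ^ b) F x = x.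
Proof.
move=> charKp Fa lt_n_pb x; apply/eqP; rewrite -subr_eq0.
have p_gt0 := prime_gt0 (pcharf_prime charKp).
have := mxminpoly_iter_affine Fa.
rewrite subrX1 sum_Xn_pchar // -exprS prednK ?expn_gt0 ?p_gt0 //.
case/dvdp_exp_XsubCP=> d _ minA.
(* By Cayley-Hamilton [d] is bounded by the dimension, whatever [a] is; so [b] may be smaller than
   [a]. *)
have le_d_n : (d <= n.+1)%N.
  have := dvdp_leq (monic_neq0 (char_poly_monic A)) (mxminpoly_dvd_char A).
  by rewrite size_char_poly (eqp_size minA) size_exp_XsubC.
rewrite iter_affine_subl sum_Xn_pchar //.
suff /mxminpoly_minP-> : mxminpoly A %| ('X - 1) ^+ (p ^ b).-1.
  by rewrite mul0mx.
rewrite (eqp_dvdl _ minA) dvdp_exp2l // (leq_trans le_d_n) //.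
by rewrite -ltnS prednK // expn_gt0 p_gt0.
Qed.

End AffineMap.

Lemma hamiltonian_order (Q : finType) (n : nat) (F : 'cV[Q]_n -> 'cV[Q]_n) :
  hamiltonian F -> forall x, order F x = (#|Q| ^ n)%N.
Proof.
case=> c /andP[cycFc Uc] size_c x; rewrite -size_c; apply: order_cycle => //.
have card_c : #|c| = #|{: 'cV[Q]_n}|.
  by rewrite card_mx muln1 -size_c; apply/card_uniqP.
by rewrite (subset_cardP card_c (subset_predT _)).
Qed.

Lemma iter_hamiltonian (Q : finType) (n : nat) (F : 'cV[Q]_n -> 'cV[Q]_n) :
  hamiltonian F -> forall x, iter (#|Q| ^ n) F x = x.
Proof.
move=> hamF x; rewrite -(hamiltonian_order hamF x).
(* Items 1 and 4: [x] returns after [order F x] steps iff [F x] and [x] have equal orders. *)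
by apply/(orbitPcycle 1 4); rewrite !(hamiltonian_order hamF).
Qed.

Theorem theorem4 (p k q n : nat) (K : finFieldType)
    (hp : prime p) (hk : (0 < k)%N) (hq : q = (p ^ k)%N) (hK : #|K| = q)
    (hn : (3 <= n)%N)
    (F : 'cV[K]_n -> 'cV[K]_n) (A : 'M[K]_n) (v : 'cV[K]_n)
    (hF : forall x : 'cV[K]_n, F x = A *m x + v) :
  ~ hamiltonian F.
Proof.
move=> hamF; have charKp : p \in [pchar K].
  by apply: (card_finPcharP (n := k)); rewrite // hK.
have ordF := hamiltonian_order hamF; have FN := iter_hamiltonian hamF.
case: n => [|n] // in hn F A v hF hamF ordF FN *.
rewrite hK hq -expnM in ordF FN.
have p_gt1 := prime_gt1 hp.
(* The dimension is now [n.+1], and it must be at least 3 here: for [p = 2] in dimension 2 the bound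
   would read [2 < 2]. *)
have lt_n_pn : (n.+1 < p ^ n)%N.
  apply: (@leq_trans (2 ^ n)); last by case: (n) => // m; rewrite leq_exp2r.
  case: n hn {F A v hF hamF ordF FN} => // n; rewrite ltnS.
  elim: n => // -[|n] // IHn _; rewrite expnS mul2n -addnn.
  by rewrite -addn1 leq_add ?IHn // expn_gt0.
have Fm := iter_affine_pchar hF charKp FN lt_n_pn 0.
(* [findex] recovers every index below the order [p ^ (k * n.+1)]; since [iter (p ^ n) F 0 = 0],
   this forces [p ^ n = 0]. *)
have := @findex_iter _ F 0%R (p ^ n); rewrite Fm findex0 ordF.
rewrite ltn_exp2l // (leq_trans (ltnSn n)) ?leq_pmull // => /(_ isT)/eqP.
by rewrite eq_sym expn_eq0 gtn_eqF // ltnW.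
Qed.
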